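(* Let $F:\mathbb{R}^d\to\mathbb{R}$ be continuously differentiable with $L$-Lipschitz gradient and strongly convex with parameter $c>0$, i.e. $F(\bar w)\ge F(w)+\nabla F(w)^\top(\bar w-w)+\tfrac c2\|\bar w-w\|_2^2$ for all $w,\bar w$; let $w_*$ be its unique minimizer and $F_*=F(w_* )$. Consider the low-precision SGD iteration $w_{k+1}=w_k-\alpha_k\,\tilde g(w_k,\xi_k)$ with $\tilde g(w_k,\xi_k)=q_k\,g(w_k,\xi_k)+\varepsilon_k$. Assume: (a) the iterates lie in an open set on which $F$ is bounded below by $F_{\inf}=F_*$; (b) there exist scalars $\mu_G\ge\mu>0$ such that for all $k$, $\nabla F(w_k)^\top\mathbb{E}_{\xi_k}[\tilde g(w_k,\xi_k)]\ge q_{\min}\mu\|\nabla F(w_k)\|_2^2$ and $\|\mathbb{E}_{\xi_k}[\tilde g(w_k,\xi_k)]\|_2\le q_{\max}\mu_G\|\nabla F(w_k)\|_2$; (c) there exist scalars $\tilde M\ge0$, $\tilde M_V\ge0$ such that for all $k$, $\mathbb{E}_{\xi_k}\|\tilde g(w_k,\xi_k)\|_2^2-\|\mathbb{E}_{\xi_k}[\tilde g(w_k,\xi_k)]\|_2^2\le\tilde M+\tilde M_V\|\nabla F(w_k)\|_2^2$. Let $\mu_q:=q_{\min}\mu$, $\tilde M_G:=\tilde M_V+q_{\max}^2\mu_G^2$, and let the stepsizes be $\alpha_k=\frac{\beta}{\gamma+k}$ with $\beta>\frac{1}{c\mu_q}$, $\gamma>0$, such that $\alpha_1\le\frac{\mu_q}{L\tilde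 M_G}$. Then for all $k\in\mathbb{N}$, \[ \mathbb{E}[F(w_k)-F_*]\le\frac{\nu_q}{\gamma+k},\qquad \nu_q:=\max\Big\{\frac{\beta^2L\tilde M}{2(\beta c\mu_q-1)},\;(\gamma+1)(F(w_1)-F_* )\Big\}. \]
   Context: The objective is $F(w)=\mathbb{E}_{\xi\sim\mathcal D}[\ell(\xi,w)]$, $w_1$ is a given initial point. At iteration $k$, $\xi_k$ is drawn i.i.d. from $\mathcal D$, $g(w_k,\xi_k)=\nabla F(w_k;\xi_k)$, $q_k\in[q_{\min},q_{\max}]\subset(0,1]$ with $q_{\min}>0$ is a shrinkage factor, and $\varepsilon_k$ is quantization noise with $\mathbb{E}[\varepsilon_k\mid\mathcal F_k]=0$ and $\mathbb{E}\|\varepsilon_k\|_2^2\le\sigma_\varepsilon^2$, $\mathcal F_k$ being the $\sigma$-algebra of all randomness up to iteration $k$. $\mathbb{E}_{\xi_k}[\cdot]$ denotes expectation over $(\xi_k,q_k,\varepsilon_k)$ conditional on $w_k$, and $\mathbb{E}[\cdot]$ is total expectation over all randomness. *)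

(* Defs.v *)
From HB Require Import structures.
From mathcomp Require Import all_boot all_order all_algebra.
From mathcomp Require Import all_classical all_reals all_analysis.
Set Implicit Arguments. Unset Strict Implicit. Unset Printing Implicit Defensive.
Import Order.TTheory GRing.Theory Num.Theory.
Import numFieldNormedType.Exports.
Local Open Scope classical_set_scope.
Local Open Scope ring_scope.

Definition dotv {R : realType} {d : nat} (u v : 'rV[R]_d) : R :=
  \sum_(i < d) u ord0 i * v ord0 i.
Definition sqnorm {R : realType} {d : nat} (v : 'rV[R]_d) : R := dotv v v.
Definition norm2 {R : realType} {d : nat} (v : 'rV[R]_d) : R := Num.sqrt (sqnorm v).

Definition is_sub_sigma {dsp : measure_display} {T : measurableType dsp}
  (G : set (set T)) : Prop :=
  sigma_algebra setT G /\ G `<=` measurable.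

Definition measurable_wrt {dsp : measure_display} {T : measurableType dsp} {R : realType}
  (G : set (set T)) (f : T -> R) : Prop :=
  forall B : set R, measurable B -> G (f @^-1` B).

Definition measurable_wrt_vec {dsp : measure_display} {T : measurableType dsp} {R : realType}
  {d : nat} (G : set (set T)) (f : T -> 'rV[R]_d) : Prop :=
  forall i : 'I_d, measurable_wrt G (fun x => f x ord0 i).

Definition is_cond_exp {dsp : measure_display} {T : measurableType dsp} {R : realType}
  (P : probability T R) (G : set (set T)) (X Y : T -> R) : Prop :=
  [/\ P.-integrable setT (EFin \o X),
      measurable_wrt G Y,
      P.-integrable setT (EFin \o Y) &
      forall A, G A -> (\int[P]_(x in A) (X x)%:E = \int[P]_(x in A) (Y x)%:E)%E].

Definition is_cond_exp_vec {dsp : measure_display} {T : measurableType dsp} {R : realType}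
  {d : nat} (P : probability T R) (G : set (set T)) (X Y : T -> 'rV[R]_d) : Prop :=
  forall i : 'I_d, is_cond_exp P G (fun x => X x ord0 i) (fun x => Y x ord0 i).

(* Main.v *)
(* The descent lemma F(v) <= F(w) + <grad F(w), v - w> + L/2 |v - w|^2, applied to
   consecutive iterates, bounds E F(w_(k+1)) by a first and a second moment of the
   stochastic gradient. As grad F(w_k) is F_k-measurable, it can be pulled out of
   the conditional expectation, so (b) controls the first moment and (b), (c) the
   second one. Since alpha_k <= alpha_1, the gain of the linear term absorbs the
   |grad F|^2 part of the noise; with the Polyak-Lojasiewicz inequality
   2 c (F - F_star) <= |grad F|^2 this leaves
     a_(k+1) <= (1 - alpha_k c mu_q) a_k + alpha_k^2 L Mt / 2
   for a_k = E[F(w_k) - F_star], and a_k <= nu / (gamma + k) follows by induction. *)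

Require Import Defs.
From HB Require Import structures.
From mathcomp Require Import all_boot all_order all_algebra.
From mathcomp Require Import all_classical all_reals all_analysis.
From mathcomp Require Import measurable_realfun.
From mathcomp Require Import ring lra.
Set Implicit Arguments.
Unset Strict Implicit.
Unset Printing Implicit Defensive.
Import Order.TTheory GRing.Theory Num.Theory.
Import numFieldNormedType.Exports.
Local Open Scope classical_set_scope.
Local Open Scope ring_scope.

(** * Inner product and Euclidean norm of row vectors *)

Section euclidean.
Variables (R : realType) (d : nat).
Implicit Types (u v h : 'rV[R]_d) (a : R).

Lemma dotvC u v : dotv u v = dotv v u.
Proof. by apply: eq_bigr => i _; rewrite mulrC. Qed.

Lemma dotvDl u v h : dotv (u + v) h = dotv u h + dotv v h.
Proof. by rewrite -big_split; apply: eq_bigr => i _; rewrite mxE mulrDl. Qed.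

Lemma dotvZl a u v : dotv (a *: u) v = a * dotv u v.
Proof. by rewrite mulr_sumr; apply: eq_bigr => i _; rewrite mxE mulrA. Qed.

Lemma dotvNl u v : dotv (- u) v = - dotv u v.
Proof. by rewrite -scaleN1r dotvZl mulN1r. Qed.

Lemma dotvDr u v h : dotv h (u + v) = dotv h u + dotv h v.
Proof. by rewrite dotvC dotvDl !(dotvC h). Qed.

Lemma dotvZr a u v : dotv v (a *: u) = a * dotv v u.
Proof. by rewrite dotvC dotvZl dotvC. Qed.

Lemma dotvNr u v : dotv v (- u) = - dotv v u.
Proof. by rewrite dotvC dotvNl dotvC. Qed.

Lemma sqnorm_ge0 u : 0 <= sqnorm u.
Proof. by apply: sumr_ge0 => i _; rewrite -expr2 sqr_ge0. Qed.

Lemma sqnormD u v : sqnorm (u + v) = sqnorm u + 2 * dotv u v + sqnorm v.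
Proof. rewrite /sqnorm dotvDl !dotvDr (dotvC v u); ring. Qed.

Lemma sqnormZ a u : sqnorm (a *: u) = a ^+ 2 * sqnorm u.
Proof. by rewrite /sqnorm dotvZl dotvZr expr2 mulrA. Qed.

Lemma sqnormN u : sqnorm (- u) = sqnorm u.
Proof. by rewrite -scaleN1r sqnormZ sqrrN expr1n mul1r. Qed.

Lemma sqnormB u v : sqnorm (u - v) = sqnorm u - 2 * dotv u v + sqnorm v.
Proof. by rewrite sqnormD dotvNr sqnormN mulrN. Qed.

Lemma sqnormD_le u v : sqnorm (u + v) <= 2 * sqnorm u + 2 * sqnorm v.
Proof. have := sqnorm_ge0 (u - v); rewrite sqnormB sqnormD; lra. Qed.

Lemma sqr_coord_le u (i : 'I_d) : u ord0 i ^+ 2 <= sqnorm u.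
Proof.
by rewrite /sqnorm /dotv (bigD1 i) //= -expr2 lerDl sumr_ge0// => j _; rewrite -expr2 sqr_ge0.
Qed.

Lemma normr_coordM_le u v (i : 'I_d) :
  `|u ord0 i * v ord0 i| <= sqnorm u + sqnorm v.
Proof.
have := sqr_coord_le u i; have := sqr_coord_le v i.
rewrite ler_norml.
have := sqr_ge0 (u ord0 i + v ord0 i); have := sqr_ge0 (u ord0 i - v ord0 i).
have := sqr_ge0 (u ord0 i); have := sqr_ge0 (v ord0 i).
by move=> *; apply/andP; split; nra.
Qed.

(** Expand the squares of [u + v] and [u - v]. The constant is not sharp; the bound serves to
    dominate an inner product by an integrable function. *)
Lemma normr_dotv_le u v : `|dotv u v| <= sqnorm u + sqnorm v.
Proof.
have := sqnorm_ge0 (u + v); have := sqnorm_ge0 (u - v).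
have := sqnorm_ge0 u; have := sqnorm_ge0 v.
by rewrite sqnormB sqnormD ler_norml => *; apply/andP; split; lra.
Qed.

Lemma sqr_norm2 u : norm2 u ^+ 2 = sqnorm u.
Proof. by rewrite sqr_sqrtr ?sqnorm_ge0. Qed.

Lemma norm2_ge0 u : 0 <= norm2 u.
Proof. exact: sqrtr_ge0. Qed.

Lemma norm2_le_sqnorm a u v :
  norm2 u <= a * norm2 v -> sqnorm u <= a ^+ 2 * sqnorm v.
Proof.
move=> uv; rewrite -!sqr_norm2 -exprMn; apply: lerXn2r (uv) => //.
- exact: norm2_ge0.
- exact: le_trans (norm2_ge0 _) uv.
Qed.

(** Expanding [0 <= sqnorm (u - a *: h)] bounds [2 * a * dotv u h] by [2 * a ^+ 2 * sqnorm h]. This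
    takes the place of Cauchy-Schwarz. *)
Lemma dotv_le_sqnorm a u h : 0 < a -> sqnorm u <= a ^+ 2 * sqnorm h ->
  dotv u h <= a * sqnorm h.
Proof.
move=> a0 uh; have := sqnorm_ge0 (u - a *: h).
rewrite sqnormB sqnormZ dotvZr => h0.
have : a * dotv u h <= a * (a * sqnorm h) by rewrite [leRHS]mulrA -expr2; lra.
by rewrite ler_pM2l.
Qed.

End euclidean.

(** * Inequalities for smooth strongly convex functions *)

Section smooth_strongly_convex.
Context {R : realType} {d : nat} {F : 'rV[R]_d -> R} {gradF : 'rV[R]_d -> 'rV[R]_d}.
Context {L c : R}.
Hypothesis F_lip : forall w v, norm2 (gradF w - gradF v) <= L * norm2 (w - v).
Hypothesis c0 : 0 < c.
Hypothesis F_sc : forall w wb,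
  F wb >= F w + dotv (gradF w) (wb - w) + c / 2 * sqnorm (wb - w).

(** Strong convexity between [0] and a nonzero [u], taken both ways, bounds the gradient increment
    along [u] from below; the Lipschitz condition bounds its norm from above. The result yields
    [0 < L] and keeps the contraction factor nonnegative. *)
Lemma sc_le_lip : (0 < d)%N -> c <= L.
Proof.
move=> d0; pose u : 'rV[R]_d := const_mx 1.
have Nu : 0 < sqnorm u.
  rewrite /sqnorm /dotv (eq_bigr (fun=> 1)); last by move=> i _; rewrite !mxE mulr1.
  by rewrite sumr_const card_ord ltr0n.
have Lu := F_lip u 0; rewrite subr0 in Lu.
have L0 : 0 <= L.
  have nu : 0 < norm2 u by rewrite sqrtr_gt0.
  by rewrite -(pmulr_lge0 _ nu); exact: le_trans (norm2_ge0 _) Lu.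
have {}Lu := norm2_le_sqnorm Lu.
have h1 := F_sc u 0; have h2 := F_sc 0 u.
rewrite sub0r dotvNr sqnormN in h1; rewrite subr0 in h2.
have cu : c * sqnorm u <= dotv (gradF u - gradF 0) u by rewrite dotvDl dotvNl; nra.
have := sqnorm_ge0 (gradF u - gradF 0 - c *: u).
rewrite sqnormB sqnormZ dotvZr => h3.
have := ler_wpM2l (ltW c0) cu; rewrite mulrA -expr2 => h4.
have {}h4 : c ^+ 2 * sqnorm u <= L ^+ 2 * sqnorm u by lra.
by rewrite ler_pM2r // ler_sqr ?nnegrE // ltW in h4.
Qed.

(* Convexity at the right endpoint of each of [n] equal pieces of the segment
   bounds the increment of [F] by the gradient there; summing the pieces yields
   the constant [L / 2] up to a factor [1 + 1 / n]. *)
Lemma descent w v : 0 < L ->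
  F v <= F w + dotv (gradF w) (v - w) + L / 2 * sqnorm (v - w).
Proof.
move=> L0; set h := v - w.
have pieces (k : R) (n : nat) : 0 < k ->
    F (w + (n%:R * k) *: h) <= F w + n%:R * k * dotv (gradF w) h
      + L * k ^+ 2 * sqnorm h * (n%:R * (n%:R + 1) / 2).
  move=> k0; elim: n => [|n IH].
    by rewrite !mul0r scale0r mulr0 !addr0.
  set y := w + (n.+1%:R * k) *: h.
  have yE : w + (n%:R * k) *: h = y - k *: h.
    rewrite /y -addrA; congr (_ + _).
    by rewrite -scalerBl -natr1; congr (_ *: _); ring.
  have := F_sc y (w + (n%:R * k) *: h).
  have -> : w + (n%:R * k) *: h - y = - (k *: h).
    by rewrite yE addrAC subrr sub0r.
  rewrite dotvNr dotvZr sqnormN.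
  have := mulr_ge0 (ltW c0) (sqnorm_ge0 (k *: h)) => sck sc.
  have a0 : 0 < L * (n.+1%:R * k) by rewrite !mulr_gt0.
  (* As [y] lies at [n.+1%:R * k] times [h] from [w], the slope along [h] has grown by at most that
     multiple of [L * sqnorm h]; summed over the pieces this gives the triangular number in
     [pieces]. *)
  have gr : dotv (gradF y - gradF w) h <= L * (n.+1%:R * k) * sqnorm h.
    apply: (dotv_le_sqnorm a0).
    have /norm2_le_sqnorm := F_lip y w.
    have -> : y - w = (n.+1%:R * k) *: h by rewrite /y addrAC subrr add0r.
    by rewrite sqnormZ mulrA -exprMn.
  rewrite dotvDl dotvNl in gr.
  have {}gr := ler_wpM2l (ltW k0) gr.
  rewrite -natr1 in gr *.
  nra.
rewrite -subr_le0; set D := _ - _.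
(* With [n.+1] pieces the excess [D] is at most [L / 2 * sqnorm h / n.+1%:R]; for large [n] this
   excludes [0 < D]. *)
suff hD n : D * n.+1%:R <= L / 2 * sqnorm h.
  rewrite leNgt; apply/negP => D0.
  have := hD (Num.truncn (L / 2 * sqnorm h / D)).
  by rewrite leNgt [D * _]mulrC -ltr_pdivrMr // truncnS_gt.
have n0 : (n.+1%:R : R) != 0 by rewrite pnatr_eq0.
have /(pieces _ n.+1) : 0 < (n.+1%:R : R)^-1 by rewrite invr_gt0.
rewrite mulfV // scale1r mul1r addrC subrK => H.
rewrite -ler_pdivlMr // /D lerBlDr; apply: le_trans H _.
rewrite le_eqVlt; apply/orP; left; apply/eqP.
by field; rewrite nat1r.
Qed.

(** Complete the square: strong convexity plus nonnegativity of the squared norm of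
    [gradF w + c *: (v - w)]. *)
Lemma polyak_lojasiewicz w v : 2 * c * (F w - F v) <= sqnorm (gradF w).
Proof.
have := ler_wpM2l (ltW (mulr_gt0 (ltr0Sn R 1) c0)) (F_sc w v).
have := sqnorm_ge0 (gradF w + c *: (v - w)).
rewrite sqnormD sqnormZ dotvZr.
by move: (dotv _ _) (sqnorm _) (sqnorm _) => *; lra.
Qed.

End smooth_strongly_convex.

(** * Measurability of continuous functions of random vectors *)

(** Turns [G] into the sigma-algebra of a measurable space, so that results on [measurable_fun]
    apply to it. *)
Lemma measurable_wrtP (dsp : measure_display) (T : measurableType dsp) (R : realType)
    (G : set (set T)) (X : T -> R) : sigma_algebra setT G ->
  measurable_wrt G X <-> measurable_fun [set: g_sigma_algebraType G] X.
Proof.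
move=> sG; split => [XG _ B mB|mX B mB].
  by rewrite setTI (measurable_g_measurableTypeE sG); exact: XG.
by have := mX measurableT _ mB; rewrite setTI (measurable_g_measurableTypeE sG).
Qed.

Lemma measurable_fun_sub (dsp : measure_display) (T : measurableType dsp) (R : realType)
    (G : set (set T)) (X : T -> R) : is_sub_sigma G ->
  measurable_wrt G X -> measurable_fun [set: T] X.
Proof. by move=> [_ Gm] XG _ B mB; rewrite setTI; exact/Gm/XG. Qed.

(* An open set of ['rV_d] is the union of the balls with rational centre and
   radius it contains, and a ball for the sup norm is a box. *)
Lemma measurable_open_rV (dsp : measure_display) (T : measurableType dsp)
    (R : realType) (d : nat) (f : T -> 'rV[R]_d) (V : set 'rV[R]_d) :
  (forall i, measurable_fun setT (fun x => f x ord0 i)) -> open V ->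
  measurable (f @^-1` V).
Proof.
move=> mf oV.
pose ctr (p : 'rV[rat]_d * nat) : 'rV[R]_d := map_mx ratr p.1.
pose rad (p : 'rV[rat]_d * nat) : R := p.2.+1%:R^-1.
have -> : f @^-1` V = \bigcup_(p in [set: 'rV[rat]_d * nat])
    if pselect (ball (ctr p) (rad p) `<=` V) then f @^-1` ball (ctr p) (rad p) else set0.
  apply/seteqP; split => x; last first.
    by move=> [p _]; case: pselect => // pV; exact: pV.
  rewrite /= => Vfx.
  have /nbhs_ballP[e /= e0 eV] : nbhs (f x) V by exact: open_nbhs_nbhs.
  (* With [dl < e / 2], a ball of radius [dl] that contains [f x] stays within [e] of [f x], hence
     in [V]. *)
  have [n [dl [dlE dl0 dle]]] : exists n dl, [/\ dl = (n.+1%:R : R)^-1, 0 < dl & dl < e / 2].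
    exists (Num.truncn (e / 2)^-1); eexists; split; first by [].
      by rewrite invr_gt0.
    by rewrite invf_plt ?posrE ?divr_gt0 // truncnS_gt.
  have /choice[r rP] : forall i, exists r : rat, `|f x ord0 i - ratr r| < dl.
    move=> i; have /rat_in_itvoo[r] : f x ord0 i - dl < f x ord0 i + dl.
      by rewrite ltrD2l gtrN.
    by rewrite in_itv /= => /andP[r1 r2]; exists r; rewrite ltr_norml; apply/andP; split; lra.
  exists (\row_i r i, n) => //.
  have rE p : rad (p, n) = dl by rewrite dlE.
  rewrite rE.
  have bx : ball (ctr (\row_i r i, n)) dl (f x).
    by split => // i j; rewrite !mxE ord1 /ball /= distrC.
  case: pselect => // ballV; exfalso; apply: ballV => y xy; apply: eV.
  apply: (@le_ball _ _ _ (dl + dl)); first lra.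
  exact: ball_triangle (ball_sym bx) xy.
apply: countable_bigcupT_measurable; first exact: countableP.
move=> p; case: pselect => /= _; last exact: measurable0.
have -> : f @^-1` ball (ctr p) (rad p) =
    \big[setI/setT]_(i < d) (fun x => f x ord0 i) @^-1` ball (ctr p ord0 i) (rad p).
  
  rewrite -bigcap_seq_cond; apply/seteqP; split => x /=.
    by move=> [_ fx] i _ /=; exact: fx.
  move=> fx; split; first by rewrite /rad invr_gt0.
  by move=> i j; rewrite ord1; apply: fx => /=; rewrite mem_index_enum.
apply: bigsetI_measurable => i _.
rewrite -[X in measurable X]setTI; apply: mf => //.
by apply: open_measurable; apply: ball_open; rewrite invr_gt0.
Qed.

(** Open intervals generate the Borel sets, and their preimages under [h] are open. *)
Lemma measurable_comp_rV (dsp : measure_display) (T : measurableType dsp)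
    (R : realType) (d : nat) (f : T -> 'rV[R]_d) (h : 'rV[R]_d -> R) :
  (forall i, measurable_fun setT (fun x => f x ord0 i)) -> continuous h ->
  measurable_fun setT (h \o f).
Proof.
move=> mf /continuousP ch.
apply: (measurability _ (RGenOpens.measurableE R)).
move=> _ [_ [a [b ->] <-]]; rewrite setTI comp_preimage.
by apply: measurable_open_rV => //; exact/ch/interval_open.
Qed.

Lemma measurable_wrt_comp (dsp : measure_display) (T : measurableType dsp)
    (R : realType) (d : nat) (G : set (set T)) (f : T -> 'rV[R]_d) (h : 'rV[R]_d -> R) :
  sigma_algebra setT G -> measurable_wrt_vec G f -> continuous h ->
  measurable_wrt G (h \o f).
Proof.
move=> sG fG ch; apply/(measurable_wrtP _ sG).
by apply: measurable_comp_rV => // i; apply/(measurable_wrtP _ sG)/fG.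
Qed.

(** * Integrable real random variables *)

Section real_integrable.
Context {dsp : measure_display} {T : measurableType dsp} {R : realType}.
Variable P : probability T R.
Implicit Types f g : T -> R.

Lemma integrable_EFinD f g :
  P.-integrable setT (EFin \o f) -> P.-integrable setT (EFin \o g) ->
  P.-integrable setT (EFin \o (fun x => f x + g x)).
Proof.
by move=> fi gi; apply: eq_integrable (integrableD measurableT fi gi) => // x _ /=.
Qed.

Lemma integrable_EFinZ a f : P.-integrable setT (EFin \o f) ->
  P.-integrable setT (EFin \o (fun x => a * f x)).
Proof.
by move=> fi; apply: eq_integrable (integrableZl measurableT a fi) => // x _ /=.
Qed.

Lemma integrable_EFin_cst a : P.-integrable setT (EFin \o (fun=> a)).
Proof. exact: finite_measure_integrable_cst. Qed.

Lemma integrable_EFin_le f g : measurable_fun setT f -> (forall x, `|f x| <= g x) ->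
  P.-integrable setT (EFin \o g) -> P.-integrable setT (EFin \o f).
Proof.
move=> mf fg; apply: le_integrable => //; first exact/measurable_EFinP.
by move=> x _; rewrite /= lee_fin (le_trans (fg x)) // ler_norm.
Qed.

(** The difference [g - f] agrees almost everywhere with its absolute value, so its integral is
    nonnegative. *)
Lemma ae_le_Rintegral f g :
  P.-integrable setT (EFin \o f) -> P.-integrable setT (EFin \o g) ->
  {ae P, forall x, f x <= g x} -> \int[P]_x f x <= \int[P]_x g x.
Proof.
move=> fi gi fg.
have hi := integrable_EFinD gi (integrable_EFinZ (-1) fi).
have -> : \int[P]_x f x = \int[P]_x g x - \int[P]_x (g x + -1 * f x).
  rewrite RintegralD //; last exact: integrable_EFinZ.
  by rewrite RintegralZl // mulN1r opprB addrC subrK.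
rewrite gerBl; set h := fun x => _.
have -> : \int[P]_x h x = \int[P]_x `|h x|.
  congr fine; apply: ae_eq_integral => //.
  - exact: measurable_int hi.
  - exact: measurable_int (integrable_norm hi).
  - by apply: filterS fg => x fg _; rewrite /h ger0_norm // mulN1r subr_ge0.
exact: Rintegral_ge0.
Qed.

End real_integrable.

(** * Pulling a measurable factor out of a conditional expectation *)

Section pull_out.
Context {dsp : measure_display} {T : measurableType dsp} {R : realType}.
Variables (P : probability T R) (G : set (set T)).
Hypothesis GP : is_sub_sigma G.

(* On the slice where [j * dl <= X < (j + 1) * dl], [X * Z + dl * `|Z|] is at least
   [j * dl * Z], whose integral vanishes. *)
Lemma pull_out_slices (X Z : T -> R) (dl : R) : 0 < dl -> measurable_wrt G X ->
  P.-integrable setT (EFin \o Z) -> P.-integrable setT (EFin \o (X \* Z)) ->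
  (forall A, G A -> (\int[P]_(x in A) (Z x)%:E = 0)%E) ->
  (0 <= \int[P]_x (X x * Z x + dl * `|Z x|)%:E)%E.
Proof.
move=> dl0 XG iZ iXZ Z0.
(* The slices are indexed by integers [j]; [pickle_inv] renumbers them by naturals, and a natural
   that codes no integer gets the empty set. *)
pose A m := if @pickle_inv int m is Some j
  then X @^-1` `[j%:~R * dl, (j + 1)%:~R * dl[ else set0.
have GA m : G (A m).
  rewrite /A; case: pickle_inv => [j|]; first by apply: XG; exact: measurable_itv.
  by case: GP => -[].
have mA m : measurable (A m) by case: GP => _; apply.
have AT : \bigcup_m A m = setT.
  apply/seteqP; split => // x _; exists (pickle (Num.floor (X x / dl))) => //.
  rewrite /A pickleK_inv /= in_itv /=.
  have /andP[f1 f2] := floor_itv (X x / dl).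
  by rewrite -ler_pdivlMr // -ltr_pdivrMr // f1.
have tA : trivIset setT A.
  move=> m n _ _ [x []].
  rewrite /A; case E : (@pickle_inv int m) => [j|//] /=; case E' : (@pickle_inv int n) => [k|//] /=.
  rewrite !in_itv /= -!ler_pdivlMr // -!ltr_pdivrMr // => /floor_def jE /floor_def kE.
  have := @pickle_invK int m; have := @pickle_invK int n.
  by rewrite /ocancel E E' /= -jE -kE => <- <-.
have iW : P.-integrable setT (EFin \o (fun x => X x * Z x + dl * `|Z x|)).
  exact: integrable_EFinD iXZ (integrable_EFinZ dl (integrable_norm iZ)).
have -> : (\int[P]_x (X x * Z x + dl * `|Z x|)%:E)%E =
    (\int[P]_(x in \bigcup_m A m) (X x * Z x + dl * `|Z x|)%:E)%E by rewrite AT.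
rewrite integral_bigcup ?AT //.
apply: nneseries_ge0 => m _ _.
case E : (@pickle_inv int m) => [j|]; last first.
  by rewrite /A E integral_set0.
have iZA : P.-integrable (A m) (EFin \o Z) by apply: integrableS iZ.
rewrite -(mule0 (j%:~R * dl)%:E) -(Z0 _ (GA m)) -integralZl //.
apply: le_integral => //.
- exact: integrableZl.
- exact: integrableS iW.
move=> x; rewrite inE /A E /= in_itv /= => /andP[X1 X2].
rewrite -EFinM lee_fin.
(* For [Z x >= 0] the lower end of the slice suffices; for [Z x < 0] the upper end costs one extra
   [dl * Z x], which the term in the absolute value repays. *)
have [z0|z0] := leP 0 (Z x).
  rewrite ger0_norm //; nra.
rewrite ltr0_norm // intrD mulrDl mul1r in X2 *; nra.
Qed.

(** Let the width [dl] of the slices tend to [0]. *)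
Lemma pull_out_ge0 (X Z : T -> R) : measurable_wrt G X ->
  P.-integrable setT (EFin \o Z) -> P.-integrable setT (EFin \o (X \* Z)) ->
  (forall A, G A -> (\int[P]_(x in A) (Z x)%:E = 0)%E) ->
  0 <= \int[P]_x (X x * Z x).
Proof.
move=> XG iZ iXZ Z0.
rewrite leNgt; apply/negP => lt0.
have h (dl : R) : 0 < dl -> 0 <= \int[P]_x (X x * Z x) + dl * \int[P]_x `|Z x|.
  move=> dl0; rewrite -RintegralZl //; last exact: integrable_norm.
  rewrite -RintegralD //; last exact: integrable_EFinZ (integrable_norm iZ).
  exact/fine_ge0/pull_out_slices.
set a := \int[P]_x (X x * Z x) in lt0 h; set b := \int[P]_x `|Z x| in h.
have b0 : 0 <= b by exact: Rintegral_ge0.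
(* For this [dl], [dl * b <= - a / 2], so [a + dl * b <= a / 2 < 0]; the [+ 1] covers [b = 0]. *)
have := h (- a / (b + 1) / 2).
have b1 : 0 < b + 1 by lra.
rewrite !divr_gt0 ?oppr_gt0 // => /(_ isT).
suff : - a / (b + 1) / 2 * b <= - a / 2 by lra.
rewrite mulrAC ler_pM2r ?invr_gt0 // mulrAC ler_pdivrMr //; nra.
Qed.

(** Both [Y - Z] and [Z - Y] integrate to [0] over every set of [G]; the one-sided bound for each
    gives equality. *)
Lemma pull_out (X Y Z : T -> R) : measurable_wrt G X ->
  is_cond_exp P G Y Z ->
  P.-integrable setT (EFin \o (X \* Y)) -> P.-integrable setT (EFin \o (X \* Z)) ->
  \int[P]_x (X x * Y x) = \int[P]_x (X x * Z x).
Proof.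
move=> XG [iY _ iZ YZ] iXY iXZ.
have key (U V : T -> R) : P.-integrable setT (EFin \o U) -> P.-integrable setT (EFin \o V) ->
    P.-integrable setT (EFin \o (X \* U)) -> P.-integrable setT (EFin \o (X \* V)) ->
    (forall A, G A -> (\int[P]_(x in A) (U x)%:E = \int[P]_(x in A) (V x)%:E)%E) ->
    \int[P]_x (X x * V x) <= \int[P]_x (X x * U x).
  move=> iU iV iXU iXV UV.
  have iXUV : P.-integrable setT (EFin \o (X \* (fun x => U x - V x))).
    have := integrableB measurableT iXU iXV.
    by apply: eq_integrable => // x _ /=; rewrite -EFinB mulrBr.
  have /= := pull_out_ge0 XG (integrableB measurableT iU iV) iXUV.
  rewrite (eq_Rintegral _ (g := fun x => X x * U x - X x * V x)); last first.
    by move=> x _ /=; rewrite mulrBr.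
  rewrite RintegralB // subr_ge0; apply => A GA.
  have mA : measurable A by case: GP => _; apply.
  under eq_integral do rewrite EFinB.
  rewrite integralB //; [|exact: integrableS iU|exact: integrableS iV].
  rewrite UV // subee //; apply: integrable_fin_num => //; exact: integrableS iV.
by apply/eqP; rewrite eq_le !key // => A /YZ.
Qed.
End pull_out.

(** * Square-integrable random vectors *)

Section square_integrable.
Context {dsp : measure_display} {T : measurableType dsp} {R : realType} {d : nat}.
Variable P : probability T R.
Implicit Types X Y Z : T -> 'rV[R]_d.

Definition square_integrable X :=
  (forall i, measurable_fun setT (fun x => X x ord0 i)) /\
  P.-integrable setT (EFin \o (fun x => sqnorm (X x))).

Lemma measurable_dotv X Y :
  (forall i, measurable_fun setT (fun x => X x ord0 i)) ->
  (forall i, measurable_fun setT (fun x => Y x ord0 i)) ->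
  measurable_fun setT (fun x => dotv (X x) (Y x)).
Proof. by move=> mX mY; apply: measurable_sum => i; exact: measurable_funM. Qed.

(** Domination is only asked almost everywhere, as the bound on the conditional mean of the
    stochastic gradient holds only there. *)
Lemma square_integrable_ae_le X f :
  (forall i, measurable_fun setT (fun x => X x ord0 i)) ->
  P.-integrable setT (EFin \o f) -> {ae P, forall x, sqnorm (X x) <= f x} ->
  square_integrable X.
Proof.
move=> mX /integrable_norm fi Xf; split => //.
have mS : measurable_fun setT (EFin \o (fun x => sqnorm (X x))).
  exact/measurable_EFinP/measurable_dotv.
apply/integrableP; split => //.
have /integrableP[mf] := fi; apply: le_lt_trans.
apply: ae_ge0_le_integral => //.
- exact: measurableT_comp.
- exact: measurableT_comp.
apply: filterS Xf => x Xf _ /=.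
by rewrite lee_fin normr_id ger0_norm ?sqnorm_ge0 // (le_trans Xf) // ler_norm.
Qed.

Lemma square_integrableD X Y : square_integrable X -> square_integrable Y ->
  square_integrable (fun x => X x + Y x).
Proof.
move=> [mX iX] [mY iY].
apply: square_integrable_ae_le (integrable_EFinD (integrable_EFinZ 2 iX) (integrable_EFinZ 2 iY)) _.
- by move=> i; under eq_fun do rewrite mxE; exact: measurable_funD.
- by apply: aeW => x; exact: sqnormD_le.
Qed.

Lemma square_integrableZ a X : square_integrable X ->
  square_integrable (fun x => a *: X x).
Proof.
move=> [mX iX]; apply: square_integrable_ae_le (integrable_EFinZ (a ^+ 2) iX) _.
- by move=> i; under eq_fun do rewrite mxE; exact: measurable_funM.
- by apply: aeW => x; rewrite sqnormZ.
Qed.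

Lemma square_integrable_cst u : square_integrable (fun=> u).
Proof. by split => [i|]; [exact: measurable_cst|exact: integrable_EFin_cst]. Qed.

Lemma integrable_dotv X Y : square_integrable X -> square_integrable Y ->
  P.-integrable setT (EFin \o (fun x => dotv (X x) (Y x))).
Proof.
move=> [mX iX] [mY iY]; apply: integrable_EFin_le (integrable_EFinD iX iY).
- exact: measurable_dotv.
- by move=> x; exact: normr_dotv_le.
Qed.

Lemma integrable_coordM X Y i : square_integrable X -> square_integrable Y ->
  P.-integrable setT (EFin \o (fun x => X x ord0 i * Y x ord0 i)).
Proof.
move=> [mX iX] [mY iY]; apply: integrable_EFin_le (integrable_EFinD iX iY).
- exact: measurable_funM.
- by move=> x; exact: normr_coordM_le.
Qed.

Lemma Rintegral_dotv X Y : square_integrable X -> square_integrable Y ->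
  \int[P]_x dotv (X x) (Y x) = \sum_(i < d) \int[P]_x (X x ord0 i * Y x ord0 i).
Proof.
move=> sX sY; rewrite /Rintegral sum_fine; last first.
  by move=> i _; apply: integrable_fin_num => //; exact: integrable_coordM.
congr fine; rewrite -integral_sum //; last by move=> i; exact: integrable_coordM.
by apply: eq_integral => x _; rewrite sumEFin.
Qed.

Lemma pull_out_dotv G X Y Z : is_sub_sigma G -> measurable_wrt_vec G X ->
  is_cond_exp_vec P G Y Z ->
  square_integrable X -> square_integrable Y -> square_integrable Z ->
  \int[P]_x dotv (X x) (Y x) = \int[P]_x dotv (X x) (Z x).
Proof.
move=> sG XG YZ sX sY sZ; rewrite !Rintegral_dotv //; apply: eq_bigr => i _.
by apply: (pull_out sG (XG i) (YZ i)); exact: integrable_coordM.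
Qed.

End square_integrable.

(** * Two deterministic estimates: continuity of Lipschitz maps and the stepsize recursion *)

Lemma lipschitz_coord_continuous (R : realType) (d : nat)
    (h : 'rV[R]_d -> 'rV[R]_d) (L : R) (i : 'I_d) : 0 < L ->
  (forall u v, norm2 (h u - h v) <= L * norm2 (u - v)) ->
  continuous (fun u => h u ord0 i).
Proof.
move=> L0 hL u; apply/(@cvgrPdist_lt _ _ _ (nbhs u) (nbhs_filter u)) => e e0.
(* A sup-norm distance below [r] means a squared Euclidean distance at most [d%:R * r ^+ 2]; this
   radius leaves [e ^+ 2] times [d / (d + 1)^2], which is below [e ^+ 2]. *)
have dl0 : 0 < e / (L * d.+1%:R) by rewrite divr_gt0 // mulr_gt0.
apply/nbhs_ballP; exists (e / (L * d.+1%:R)) => //= v [_ uv].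
have /norm2_le_sqnorm huv := hL u v.
rewrite -ltr_sqr ?nnegrE ?normr_ge0 ?(ltW e0) // real_normK ?num_real //.
have := sqr_coord_le (h u - h v) i; rewrite !mxE => /le_lt_trans; apply.
apply: le_lt_trans huv _.
have N : sqnorm (u - v) <= d%:R * (e / (L * d.+1%:R)) ^+ 2.
  rewrite mulr_natl -[X in _ *+ X]card_ord -sumr_const; apply: ler_sum => j _.
  rewrite -expr2 -real_normK ?num_real // !mxE ler_sqr ?nnegrE ?(ltW dl0) //.
  exact/ltW/(uv ord0 j).
apply: le_lt_trans (ler_wpM2l (sqr_ge0 L) N) _.
have -> : L ^+ 2 * (d%:R * (e / (L * d.+1%:R)) ^+ 2) = e ^+ 2 * (d%:R / d.+1%:R ^+ 2).
  by field; rewrite (gt_eqF L0) andbT nat1r pnatr_eq0.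
rewrite gtr_pMr ?exprn_gt0 // ltr_pdivrMr ?exprn_gt0 // mul1r.
by rewrite -natrX ltr_nat expnS expn1 mulSn ltn_addr.
Qed.

(* Here [t] is [gamma + k], [rho] is [c * mu_q] and [A] is [L * Mt / 2]. *)
Lemma stepsize_induction (R : realType) (a nu A beta rho t : R) :
  0 < t -> 0 <= nu -> 0 <= 1 - beta / t * rho ->
  beta ^+ 2 * A <= nu * (beta * rho - 1) -> a <= nu / t ->
  (1 - beta / t * rho) * a + (beta / t) ^+ 2 * A <= nu / (t + 1).
Proof.
move=> t0 nu0 r0 hA /(ler_wpM2l r0) ha; apply: le_trans (lerD ha (lexx _)) _.
have -> : (1 - beta / t * rho) * (nu / t) + (beta / t) ^+ 2 * A =
    (nu * t - nu * (beta * rho) + beta ^+ 2 * A) / t ^+ 2.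
  by field; rewrite gt_eqF.
rewrite ler_pdivrMr ?exprn_gt0 // [leRHS]mulrAC ler_pdivlMr ?addr_gt0 //.
(* The condition on [nu] brings the numerator down to [nu * (t - 1)], and
   [(t - 1) * (t + 1) <= t ^+ 2]. *)
have h : nu * t - nu * (beta * rho) + beta ^+ 2 * A <= nu * (t - 1) by lra.
apply: le_trans (ler_wpM2r (ltW (addr_gt0 t0 ltr01)) h) _.
nra.
Qed.

(** * Expected decrease in one iteration *)

Section expected_descent.
Context {R : realType} {d : nat} {F : 'rV[R]_d -> R} {gradF : 'rV[R]_d -> 'rV[R]_d}.
Context {L c : R} {wstar : 'rV[R]_d}.
Hypothesis F_cont : continuous F.
Hypothesis F_lip : forall w v, norm2 (gradF w - gradF v) <= L * norm2 (w - v).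
Hypothesis c0 : 0 < c.
Hypothesis F_sc : forall w wb,
  F wb >= F w + dotv (gradF w) (wb - w) + c / 2 * sqnorm (wb - w).
Hypothesis F_min : forall w, F wstar <= F w.
Hypothesis L0 : 0 < L.
Context {dsp : measure_display} {T : measurableType dsp}.
Variable P : probability T R.

(** A Lipschitz gradient grows at most linearly. *)
Lemma square_integrable_gradient W : square_integrable P W ->
  square_integrable P (gradF \o W).
Proof.
move=> sW; have s0 := square_integrable_cst P (gradF 0).
pose f x := 2 * (L ^+ 2 * sqnorm (W x)) + 2 * sqnorm (gradF 0).
apply: (@square_integrable_ae_le _ _ _ _ _ _ f).
- move=> i; apply: (@measurable_comp_rV _ _ _ _ W (fun u => gradF u ord0 i)).
    by case: sW.
  exact: lipschitz_coord_continuous L0 F_lip.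
- apply: integrable_EFinD; last exact: integrable_EFin_cst.
  by do 2!apply: integrable_EFinZ; case: sW.
- apply: aeW => x; rewrite /f /= -[gradF (W x)](subrK (gradF 0)).
  apply: le_trans (sqnormD_le _ _) _; rewrite lerD2r ler_pM2l //.
  by have /norm2_le_sqnorm := F_lip (W x) 0; rewrite subr0.
Qed.

(** The gap lies between [0] and the quadratic bound of [descent] at [wstar]. *)
Lemma integrable_objective_gap W : square_integrable P W ->
  P.-integrable setT (EFin \o (fun x => F (W x) - F wstar)).
Proof.
move=> sW; have s0 := square_integrable_cst P (gradF wstar).
have sD := square_integrableD sW (square_integrable_cst P (- wstar)).
apply: integrable_EFin_le (integrable_EFinD (integrable_dotv s0 sD)
    (integrable_EFinZ (L / 2) sD.2)).
  apply: measurable_funB => //.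
  by apply: (@measurable_comp_rV _ _ _ _ W F) => //; case: sW.
move=> x; rewrite ger0_norm ?subr_ge0 // lerBlDl addrA.
exact: descent F_lip c0 F_sc _ _ L0.
Qed.

Lemma expected_descent (G : set (set T)) (W Gt m : T -> 'rV[R]_d) (s : T -> R)
    (alpha muq MG Mt MV : R) :
  is_sub_sigma G -> measurable_wrt_vec G W -> square_integrable P W ->
  is_cond_exp_vec P G Gt m -> is_cond_exp P G (fun x => sqnorm (Gt x)) s ->
  {ae P, forall x, muq * sqnorm (gradF (W x)) <= dotv (gradF (W x)) (m x) /\
    sqnorm (m x) <= MG * sqnorm (gradF (W x))} ->
  {ae P, forall x, s x - sqnorm (m x) <= Mt + MV * sqnorm (gradF (W x))} ->
  0 <= alpha -> 0 <= muq -> alpha * (L * (MV + MG)) <= muq ->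
  \int[P]_x (F (W x - alpha *: Gt x) - F wstar) <=
    (1 - alpha * (c * muq)) * \int[P]_x (F (W x) - F wstar) + alpha ^+ 2 * (L * Mt / 2).
Proof.
move=> sG WG sW Gtm Gts hm hs alpha0 muq0 halpha.
have sg := square_integrable_gradient sW.
have iF := integrable_objective_gap sW.
have mGt i : measurable_fun setT (fun x => Gt x ord0 i).
  by case: (Gtm i) => /measurable_int/measurable_EFinP.
have sGt : square_integrable P Gt by split => //; case: Gts.
have sm : square_integrable P m.
  apply: (square_integrable_ae_le (f := fun x => MG * sqnorm (gradF (W x)))).
  - by move=> i; case: (Gtm i) => _ /(measurable_fun_sub sG).
  - exact: integrable_EFinZ sg.2.
  - by apply: filterS hm => x [].
have sW' : square_integrable P (fun x => W x - alpha *: Gt x).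
  by under eq_fun do rewrite -scaleNr; exact: square_integrableD sW (square_integrableZ _ sGt).
have is' : P.-integrable setT (EFin \o s) by case: Gts.
have igGt := integrable_dotv sg sGt.
have igm := integrable_dotv sg sm.
set EF := \int[P]_x (F (W x) - F wstar).
pose Eg := \int[P]_x sqnorm (gradF (W x)).
have gW : measurable_wrt_vec G (gradF \o W).
  move=> i; apply: (@measurable_wrt_comp _ _ _ _ G W (fun u => gradF u ord0 i)) => //.
    by case: sG.
  exact: lipschitz_coord_continuous L0 F_lip.
have Edot : muq * Eg <= \int[P]_x dotv (gradF (W x)) (Gt x).
  rewrite (pull_out_dotv sG gW Gtm sg sGt sm) -RintegralZl //; last exact: sg.2.
  apply: ae_le_Rintegral => //; first exact: integrable_EFinZ sg.2.
  by apply: filterS hm => x [].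
(* Since [setT] belongs to [G], [s] has the same mean as [sqnorm (Gt x)]; both moment bounds then
   apply to [s]. *)
have Esq : \int[P]_x sqnorm (Gt x) <= Mt + (MV + MG) * Eg.
  have -> : \int[P]_x sqnorm (Gt x) = \int[P]_x s x.
    case: Gts => _ _ _ GtsE; congr fine; apply: GtsE.
    by case: sG => -[G0 GC _] _; rewrite -(setD0 setT); exact: GC.
  have -> : Mt + (MV + MG) * Eg = \int[P]_x (Mt + (MV + MG) * sqnorm (gradF (W x))).
    rewrite RintegralD //; [|exact: integrable_EFin_cst|exact: integrable_EFinZ sg.2].
    rewrite RintegralZl //; last exact: sg.2.
    have PT : fine (P setT) = 1 by rewrite probability_setT.
    by rewrite Rintegral_cst // PT mulr1.
  apply: ae_le_Rintegral => //.
    by apply: integrable_EFinD; [exact: integrable_EFin_cst|exact: integrable_EFinZ sg.2].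
  by apply: filterS2 hm hs => x [_ h1] h2; lra.
have Epl : 2 * c * EF <= Eg.
  rewrite -RintegralZl //; apply: le_Rintegral => //; first exact: integrable_EFinZ iF.
    exact: sg.2.
  by move=> x _; exact: polyak_lojasiewicz c0 F_sc _ _.
have step : \int[P]_x (F (W x - alpha *: Gt x) - F wstar) <=
    EF + (- alpha * \int[P]_x dotv (gradF (W x)) (Gt x)
      + L / 2 * alpha ^+ 2 * \int[P]_x sqnorm (Gt x)).
  have i1 := integrable_EFinZ (- alpha) igGt.
  have i2 := integrable_EFinZ (L / 2 * alpha ^+ 2) sGt.2.
  rewrite -!RintegralZl //; last exact: sGt.2.
  rewrite -RintegralD // -RintegralD //; last exact: integrable_EFinD i1 i2.
  apply: le_Rintegral => //.
  - exact: integrable_objective_gap sW'.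
  - exact: integrable_EFinD iF (integrable_EFinD i1 i2).
  move=> x _; have := descent F_lip c0 F_sc (W x) (W x - alpha *: Gt x) L0.
  by rewrite [W x - _ - W x]addrAC subrr sub0r dotvNr dotvZr sqnormN sqnormZ; nra.
have h1 := ler_wpM2l alpha0 Edot.
have La : 0 <= L / 2 * alpha ^+ 2 by rewrite mulr_ge0 ?sqr_ge0 // divr_ge0 // ltW.
have h2 := ler_wpM2l La Esq.
have Eg0 : 0 <= Eg by apply: Rintegral_ge0 => x _; exact: sqnorm_ge0.
(* The stepsize bound lets the noise use up at most half of the gain [alpha * muq * Eg]; the other
   half becomes [alpha * (c * muq) * EF] through [Epl]. *)
have h3 := ler_wpM2l (mulr_ge0 alpha0 Eg0) halpha.
have h4 := ler_wpM2l (mulr_ge0 alpha0 muq0) Epl.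
apply: le_trans step _.
lra.
Qed.

End expected_descent.

(** * The convergence rate, by induction on the iterations *)

Theorem theorem2
  (R : realType) (d : nat)
  (* objective, its gradient, constants *)
  (F : 'rV[R]_d -> R) (gradF : 'rV[R]_d -> 'rV[R]_d) (L c : R) (wstar : 'rV[R]_d)
  (HFdiff : forall w, differentiable F w)
  (HFgrad : forall w h, 'd F w h = dotv (gradF w) h)
  (HLip : forall w v, norm2 (gradF w - gradF v) <= L * norm2 (w - v))
  (Hc : 0 < c)
  (Hsc : forall w wb, F wb >= F w + dotv (gradF w) (wb - w) + c / 2 * sqnorm (wb - w))
  (Hmin : forall w, F wstar <= F w)
  (* probability space and filtration *)
  (dsp : measure_display) (T : measurableType dsp) (P : probability T R)
  (Fk : nat -> set (set T))
  (HFk : forall k, is_sub_sigma (Fk k))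
  (HFmono : forall k, Fk k `<=` Fk k.+1)
  (* process: iterates, stochastic gradients g(w_k, xi_k), shrinkage, noise *)
  (w : nat -> T -> 'rV[R]_d) (w1 : 'rV[R]_d)
  (g : nat -> T -> 'rV[R]_d) (q : nat -> T -> R) (eps : nat -> T -> 'rV[R]_d)
  (qmin qmax sigeps : R)
  (Hq01 : 0 < qmin /\ qmin <= qmax /\ qmax <= 1)
  (alpha : nat -> R) (beta gamma : R)
  (Hw1 : w 1%N = fun _ => w1)
  (Hwadapt : forall k, (1 <= k)%N -> measurable_wrt_vec (Fk k) (w k))
  (Hgmeas : forall k, (1 <= k)%N -> measurable_wrt_vec (Fk k.+1) (g k))
  (Hqmeas : forall k, (1 <= k)%N -> measurable_wrt (Fk k.+1) (q k))
  (Hepsmeas : forall k, (1 <= k)%N -> measurable_wrt_vec (Fk k.+1) (eps k))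
  (Hqbd : forall k x, (1 <= k)%N -> qmin <= q k x <= qmax)
  (Heps0 : forall k, (1 <= k)%N -> is_cond_exp_vec P (Fk k) (eps k) (fun _ => 0))
  (Hepsvar : forall k, (1 <= k)%N ->
     (\int[P]_x (sqnorm (eps k x))%:E <= sigeps%:E)%E)
  (Hiter : forall k x, (1 <= k)%N ->
     w k.+1 x = w k x - alpha k *: (q k x *: g k x + eps k x))
  (* (a) *)
  (Ha : exists U : set 'rV[R]_d, [/\ open U,
          (forall k x, (1 <= k)%N -> U (w k x)) &
          (forall v, U v -> F wstar <= F v)])
  (* conditional moments of gtilde_k = q_k g_k + eps_k given F_k *)
  (m : nat -> T -> 'rV[R]_d) (s : nat -> T -> R)
  (Hm : forall k, (1 <= k)%N ->
     is_cond_exp_vec P (Fk k) (fun x => q k x *: g k x + eps k x) (m k))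
  (Hs : forall k, (1 <= k)%N ->
     is_cond_exp P (Fk k) (fun x => sqnorm (q k x *: g k x + eps k x)) (s k))
  (* (b) *)
  (mu muG : R) (Hmu : 0 < mu) (HmuG : mu <= muG)
  (Hb : forall k, (1 <= k)%N -> {ae P, forall x,
     dotv (gradF (w k x)) (m k x) >= qmin * mu * sqnorm (gradF (w k x)) /\
     norm2 (m k x) <= qmax * muG * norm2 (gradF (w k x))})
  (* (c) *)
  (Mt MV : R) (HMt : 0 <= Mt) (HMV : 0 <= MV)
  (Hcc : forall k, (1 <= k)%N -> {ae P, forall x,
     s k x - sqnorm (m k x) <= Mt + MV * sqnorm (gradF (w k x))})
  (* stepsizes *)
  (Halpha : forall k, alpha k = beta / (gamma + k%:R))
  (Hbeta : beta > 1 / (c * (qmin * mu)))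
  (Hgamma : 0 < gamma)
  (Halpha1 : alpha 1%N <= (qmin * mu) / (L * (MV + qmax ^+ 2 * muG ^+ 2))) :
  forall k, (1 <= k)%N ->
    (\int[P]_x ((F (w k x) - F wstar)%:E) <=
      (Num.max (beta ^+ 2 * L * Mt / (2 * (beta * c * (qmin * mu) - 1)))
               ((gamma + 1) * (F w1 - F wstar)) / (gamma + k%:R))%:E)%E.
Proof.
case: Hq01 => qmin0 [qminmax _].
set muq := qmin * mu; set MG := qmax ^+ 2 * muG ^+ 2.
set nu := Num.max _ _.
have muq0 : 0 < muq by exact: mulr_gt0.
have beta_rho : 1 < beta * c * muq.
  have := Hbeta; rewrite ltr_pdivrMr ?mulr_gt0 //.
  by rewrite -/muq mulrA.
have beta0 : 0 < beta.
  by apply: lt_trans Hbeta; rewrite divr_gt0 ?mulr_gt0.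
have t0 k : 0 < gamma + k%:R by rewrite ltr_wpDr.
have gap1 : 0 <= (gamma + 1) * (F w1 - F wstar).
  by rewrite mulr_ge0 ?subr_ge0 ?Hmin ?addr_ge0 ?(ltW Hgamma) ?ler01.
have nu0 : 0 <= nu by rewrite /nu le_max gap1 orbT.
(* In dimension [0] nothing forces [L] to be positive. *)
have [d0|dgt0] := posnP d.
  move=> k k1.
  have wE x : F (w k x) - F wstar = 0.
    have -> : w k x = wstar by apply/rowP => -[j jd]; exfalso; rewrite d0 in jd.
    exact: subrr.
  under eq_integral do rewrite wE.
  by rewrite integral0 lee_fin divr_ge0 // ltW // t0.
have cL : c <= L := sc_le_lip HLip Hc Hsc dgt0.
have L0 : 0 < L := lt_le_trans Hc cL.
have Fcont : continuous F by move=> u; exact: differentiable_continuous.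
have qmax0 : 0 < qmax := lt_le_trans qmin0 qminmax.
have muG0 : 0 < muG := lt_le_trans Hmu HmuG.
have muqMG : muq ^+ 2 <= MG.
  rewrite /MG /muq -exprMn ler_sqr ?nnegrE ?(ltW (mulr_gt0 _ _)) //.
  by apply: ler_pM => //; exact: ltW.
have MVG0 : 0 < MV + MG by rewrite ltr_wpDl // mulr_gt0 ?exprn_gt0.
have alpha0 k : 0 < alpha k by rewrite Halpha divr_gt0.
(* The stepsizes decrease, so the bound on the first one holds for all. *)
have alpha_le k : (1 <= k)%N -> alpha k * (L * (MV + MG)) <= muq.
  move=> k1; rewrite -ler_pdivlMr ?mulr_gt0 //; apply: le_trans Halpha1.
  by rewrite !Halpha ler_pM2l // lef_pV2 ?posrE // lerD2l ler_nat.
(* From [c <= L] and [muq ^+ 2 <= MG], [c * muq ^+ 2] is at most [L * (MV + MG)]; then [alpha_le]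
   applies. *)
have rate_le k : (1 <= k)%N -> 0 <= 1 - alpha k * (c * muq).
  move=> /alpha_le ak; have ak0 := alpha0 k.
  rewrite subr_ge0 -(ler_pM2r muq0) mul1r; apply: le_trans ak.
  rewrite -mulrA ler_pM2l // -mulrA -expr2.
  apply: ler_pM => //; [exact: ltW|exact: sqr_ge0|].
  by apply: le_trans muqMG _; rewrite lerDr.
(* Square integrability passes from each iterate to the next: [w1] is constant and [Hs] makes every
   stochastic gradient square-integrable. *)
have sqw k : (1 <= k)%N -> square_integrable P (w k).
  elim: k => // -[_ _|k IH _]; first by rewrite Hw1; exact: square_integrable_cst.
  under [w _]funext do rewrite Hiter //.
  under eq_fun do rewrite -scaleNr.
  apply: square_integrableD (IH isT) (square_integrableZ _ _); split.
    by move=> i; case: (Hm k.+1 isT i) => /measurable_int/measurable_EFinP.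
  by case: (Hs k.+1 isT).
have main k : (1 <= k)%N -> \int[P]_x (F (w k x) - F wstar) <= nu / (gamma + k%:R).
  elim: k => // -[_ _|k IH _].
    rewrite Hw1 Rintegral_cst //.
    have -> : fine (P setT) = 1 by rewrite probability_setT.
    by rewrite mulr1 ler_pdivlMr // mulrC /nu le_max lexx orbT.
  have {}IH := IH isT.
  have hm : {ae P, forall x, muq * sqnorm (gradF (w k.+1 x)) <=
        dotv (gradF (w k.+1 x)) (m k.+1 x) /\
      sqnorm (m k.+1 x) <= MG * sqnorm (gradF (w k.+1 x))}.
    apply: filterS (Hb k.+1 isT) => x [h1 h2]; split => //.
    by rewrite /MG -exprMn; exact: norm2_le_sqnorm.
  have := expected_descent Fcont HLip Hc Hsc Hmin L0 (HFk k.+1) (Hwadapt k.+1 isT) (sqw k.+1 isT)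
    (Hm k.+1 isT) (Hs k.+1 isT) hm (Hcc k.+1 isT)
    (ltW (alpha0 k.+1)) (ltW muq0) (alpha_le k.+1 isT).
  rewrite (eq_Rintegral _ (g := fun x => F (w k.+2 x) - F wstar)); last first.
    by move=> x _; rewrite -Hiter.
  move=> /le_trans; apply.
  have := rate_le k.+1 isT; rewrite Halpha => rk.
  rewrite -[in leRHS]natr1 addrA.
  apply: stepsize_induction => //.
  (* The first entry of the maximum supplies the condition on [nu] in the recursion; the second one
     settled the base case. *)
  have : beta ^+ 2 * L * Mt / (2 * (beta * c * muq - 1)) <= nu by rewrite /nu le_max lexx.
  have b1 : 0 < beta * c * muq - 1 by rewrite subr_gt0.
  rewrite ler_pdivrMr ?mulr_gt0 // !mulrA; lra.
move=> k k1.
(* The gap is integrable, so its extended-real integral is finite and [main] applies. *)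
rewrite -[leLHS]fineK ?lee_fin; first exact: main.
apply: integrable_fin_num => //.
exact: (integrable_objective_gap Fcont HLip Hc Hsc Hmin L0 (sqw k k1)).
Qed.
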